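(* Let $n\geq 3$ and let $\mathcal{F}\subseteq 2^{[n]}$ be a family of subsets of $[n]=\{1,\ldots,n\}$ containing no four distinct members $A,B,C,D\in\mathcal{F}$ with $A\cup B\subseteq C\cap D$. Then $$|\mathcal{F}|\leq \binom{n}{\lfloor n/2\rfloor}+\binom{n}{\lfloor n/2\rfloor+1}.$$ *)

(* Defs.v *)
From mathcomp Require Import all_boot.

Set Implicit Arguments.
Unset Strict Implicit.
Unset Printing Implicit Defensive.

(* Weak subposet containment: no relation is excluded between A and B, nor
   between C and D, beyond the four sets being pairwise distinct. *)
Definition butterfly_free (T : finType) (F : {set {set T}}) : Prop :=
  ~ exists A B C D : {set T},
      [/\ A \in F, B \in F, C \in F & D \in F] /\
      uniq [:: A; B; C; D] /\ A :|: B \subset C :&: D.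

(* Main.v *)
Require Import Defs.
From mathcomp Require Import all_boot perm fingroup zify.

(* Suppose first that neither the empty set nor [n] is in F, and average
   |F :&: C| over the n! full chains C. A member M of F lying strictly between
   two other members has exactly one member A below it and one member B above
   it. A transposition moves A off itself while fixing M, so at most half of
   the chains through M meet A, and likewise B; hence the chains through M meet
   F at most 2 times on average, while a chain avoiding such M meets F at most
   twice. So the sum of 1 / 'C(n, |A|) over F is at most 2, which gives the
   bound since a level contributes at most 1 to this sum. If the empty set is in
   F, it can be exchanged for a singleton not in F; if all singletons are in F,
   the other nonempty members are pairwise disjoint and |F| <= 2n. The full set
   is treated by complementation. *)

(** * Binomial coefficients around the middle level *)

Lemma leq_bin_decr n k : n <= k.*2.+1 -> 'C(n, k.+1) <= 'C(n, k).
Proof.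
move=> nk; have := mul_bin_left n k; have := bin_gt0 n k.
have [kn _|kn _ _] := leqP k n; last by rewrite bin_small // ltnS ltnW.
move=> e; rewrite -(leq_pmul2l (ltn0Sn k)) e leq_mul2r.
by apply/orP; right; lia.
Qed.

Lemma leq_bin_upper n h k : n <= h.*2.+1 -> h <= k -> 'C(n, k) <= 'C(n, h).
Proof.
move=> nh /subnK <-; elim: (k - h) => // d; apply: leq_trans.
by rewrite addSn leq_bin_decr //; lia.
Qed.

(** The coefficients do not increase from [(n %/ 2).+1] on, and a [k] below [n %/ 2] is reflected to
    [n - k], which lies in that range. *)
Lemma leq_bin_off_middle n k :
  k <= n -> k != n %/ 2 -> 'C(n, k) <= 'C(n, (n %/ 2).+1).
Proof.
move=> kn knh; have [hk|kh] := ltnP (n %/ 2) k.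
  by apply: leq_bin_upper => //; lia.
by rewrite -bin_sub //; apply: leq_bin_upper; lia.
Qed.

Lemma leq_bin_inner n k : 0 < k < n -> n <= 'C(n, k).
Proof.
elim: n k => [|n IHn] [|k] //=; rewrite ltnS => kn.
rewrite binS; have [kn'|nk] := ltnP k.+1 n.
  by rewrite -addn1 leq_add ?IHn // bin_gt0 ltnW.
have -> : n = k.+1 by lia.
by rewrite binn binSn add1n.
Qed.

(** * Full chains and the action of permutations *)

(** Induction on [#|A :\: B|]: a transposition trades a point of [A :\: B] for one of [B :\: A]. *)
Lemma imset_trans {T : finType} (A B : {set T}) :
  #|A| = #|B| -> exists t : {perm T}, t @: A = B.
Proof.
have [m] := ubnP #|A :\: B|; elim: m A => // m IHm A AB_m cardAB.
have [AB|] := set_0Vmem (A :\: B).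
  exists 1%g; rewrite (eq_imset (g := id)) ?imset_id; last by move=> x; rewrite perm1.
  by apply/eqP; rewrite eqEcard cardAB leqnn andbT -setD_eq0 AB.
case=> x /setDP[xA xB].
have /card_gt0P[y /setDP[yB yA]] : 0 < #|B :\: A|.
  have : 0 < #|A :\: B| by apply/card_gt0P; exists x; rewrite inE xB.
  by rewrite !cardsD setIC cardAB.
pose A' := y |: A :\ x.
have tA : tperm x y @: A = A'.
  apply/setP=> z; apply/imsetP/setU1P => [[u uA ->]|].
    case: tpermP uA => [|->|]; [by left| by rewrite (negPf yA) | right].
    by rewrite !inE uA andbT; apply/eqP.
  case=> [->|/setD1P[zx zA]]; first by exists x; rewrite ?tpermL.
  exists z => //; rewrite tpermD //; first by rewrite eq_sym.
  by apply: contraNneq yA => ->.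
have [||t tB] := IHm A'; last 1 first.
- exists (tperm x y * t)%g; rewrite -tB -tA -imset_comp.
  by apply: eq_imset => z; rewrite permM.
- apply: (@leq_trans #|A :\: B|); last by [].
  apply: proper_card.
  apply/properP; split; last first.
    exists x; rewrite !inE ?xA ?xB // eqxx /= orbF.
    by apply: contraNneq yA => <-.
  apply/subsetP=> z; rewrite !inE => /andP[zB /orP[/eqP zy|/andP[_ ->]]].
    by rewrite zy yB in zB.
  by rewrite zB.
- by rewrite -tA card_imset ?cardAB //; apply: perm_inj.
Qed.

(* The full chain of subsets of ['I_n] associated with [s]: the sets
   [{s 0, ..., s (k - 1)}] for [k <= n]. *)
Definition full_chain n (s : {perm 'I_n}) : {set {set 'I_n}} :=
  [set A : {set 'I_n} | s @: [set i : 'I_n | i < #|A|] == A].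

Definition chains_through n (A : {set 'I_n}) : {set {perm 'I_n}} :=
  [set s | A \in full_chain n s].

Lemma in_chains_through n s A :
  (s \in chains_through n A) = (A \in full_chain n s).
Proof. by rewrite inE. Qed.

Lemma full_chain_sub n s A B :
  A \in full_chain n s -> B \in full_chain n s -> #|A| <= #|B| -> A \subset B.
Proof.
rewrite !inE => /eqP As /eqP Bs AB; rewrite -As -Bs; apply: imsetS.
by apply/subsetP=> i; rewrite !inE => /leq_trans; apply.
Qed.

(** The product [s * t] applies [s] first, so right multiplication by [t] carries a chain to its
    image under [t]. *)
Lemma full_chain_perm n (s t : {perm 'I_n}) (A : {set 'I_n}) :
  (t @: A \in full_chain n (s * t)%g) = (A \in full_chain n s).
Proof.
rewrite !inE card_imset; last exact: perm_inj.
rewrite -[RHS](inj_eq (imset_inj (@perm_inj _ t))) -imset_comp.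
by congr (_ == _); apply: eq_imset => z; rewrite permM.
Qed.

Lemma chains_through_imset n (t : {perm 'I_n}) (A : {set 'I_n}) :
  #|chains_through n (t @: A)| = #|chains_through n A|.
Proof.
rewrite -(card_imset (chains_through n A) (mulIg t)); apply: eq_card => s.
apply/idP/imsetP => [|[u]]; rewrite in_chains_through.
  move=> tAs; exists (s * t^-1)%g; last by rewrite mulgKV.
  by rewrite in_chains_through -(full_chain_perm _ _ t) mulgKV.
by move=> Au ->; rewrite in_chains_through full_chain_perm.
Qed.

Lemma full_chain_level n (s : {perm 'I_n}) k :
  k <= n -> #|[set A in full_chain n s | #|A| == k]| = 1.
Proof.
move=> kn; pose I := [set i : 'I_n | i < k].
have cI : #|I| = k.
  rewrite -sum1_card; under eq_bigl do rewrite inE.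
  by rewrite -(big_ord_widen n (fun=> 1)) // sum1_card card_ord.
apply/eqP/cards1P; exists (s @: I); apply/setP=> A; rewrite !inE.
apply/andP/eqP => [[/eqP As /eqP cA]|->]; first by rewrite -As cA.
by rewrite card_imset ?cI //; apply: perm_inj.
Qed.

Lemma sum_card_full_chain n (S : {set {perm 'I_n}}) (G : {set {set 'I_n}}) :
  \sum_(s in S) #|G :&: full_chain n s| =
  \sum_(A in G) #|chains_through n A :&: S|.
Proof.
pose r s A : nat := A \in full_chain n s.
transitivity (\sum_(s in S) \sum_(A in G) r s A).
  apply: eq_bigr => s _; rewrite -big_mkcondr -sum1_card /=.
  by apply: eq_bigl => A; rewrite in_setI.
rewrite exchange_big /=; apply: eq_bigr => A _; rewrite -big_mkcondr -sum1_card /=.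
by apply: eq_bigl => s; rewrite in_setI in_chains_through andbC.
Qed.

Lemma sum_chains_through n (G : {set {set 'I_n}}) :
  \sum_s #|G :&: full_chain n s| = \sum_(A in G) #|chains_through n A|.
Proof.
have := sum_card_full_chain n setT G; under eq_bigl do rewrite inE.
by move=> ->; apply: eq_bigr => A _; rewrite setIT.
Qed.

Lemma sum_level n k :
  k <= n -> \sum_(A : {set 'I_n} | #|A| == k) #|chains_through n A| = n`!.
Proof.
move=> kn; have := sum_chains_through n [set A : {set 'I_n} | #|A| == k].
under [RHS]eq_bigl do rewrite inE; move=> <-.
rewrite (eq_bigr (fun=> 1)) ?sum1_card ?card_Sn // => s _.
rewrite -[RHS](full_chain_level n s k) //.
by apply: eq_card => B; rewrite !inE andbC.
Qed.

(** By transitivity all sets of one size lie on equally many chains, and each chain meets a level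
    once. So [#|chains_through n A|] serves as the weight 1 / 'C(n, |A|), scaled by n! to stay in
    [nat]. *)
Lemma card_chains_through n (A : {set 'I_n}) :
  #|chains_through n A| * 'C(n, #|A|) = n`!.
Proof.
have cA : #|A| <= n by rewrite -[n in _ <= n]card_ord max_card.
rewrite -(sum_level n #|A| cA) -[n in 'C(n, _)]card_ord -card_draws.
rewrite mulnC -sum_nat_const.
apply: eq_big => [B|B]; rewrite inE // => /eqP cB.
by have [|t <-] := imset_trans A B; rewrite ?cB ?chains_through_imset.
Qed.

(** Right multiplication by [tperm x y] sends the chains through [A] and [M] injectively to chains
    through [M] that miss [A], since a chain has only one set of each size. The condition on [x] and
    [y] covers both [A] below [M] (both points inside [M]) and [A] above [M] (both outside). *)
Lemma chains_through_half n (A M : {set 'I_n}) x y :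
  x \in A -> y \notin A -> (x \in M) = (y \in M) ->
  #|chains_through n A :&: chains_through n M| * 2 <= #|chains_through n M|.
Proof.
move=> xA yA xyM; set S := _ :&: _; pose t := tperm x y.
have tM : t @: M = M.
  apply/eqP; rewrite eqEcard card_imset ?leqnn ?andbT; last exact: perm_inj.
  apply/subsetP=> _ /imsetP[z zM ->]; rewrite /t.
  by case: tpermP zM => [->|->|//]; rewrite xyM.
pose S' := [set (s * t)%g | s in S].
have SS' : [disjoint S & S'].
  apply/pred0P=> s /=; apply: contraNF yA => /andP[].
  rewrite inE !in_chains_through => /andP[As _] /imsetP[u].
  rewrite inE !in_chains_through => /andP[+ _] su.
  rewrite -(full_chain_perm n u t A) => Au.
  move: As Au; rewrite su => As Au.
  have := full_chain_sub _ _ _ _ Au As; rewrite card_imset ?leqnn; last exact: perm_inj.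
  by move=> /(_ isT)/subsetP; apply; apply/imsetP; exists x; rewrite ?tpermL.
have -> : #|S| * 2 = #|S :|: S'|.
  case: (leq_card_setU S S') => _; rewrite SS' => /eqP ->.
  by rewrite card_imset ?muln2 ?addnn //; apply: mulIg.
apply: subset_leq_card; rewrite subUset subsetIr; apply/subsetP=> _ /imsetP[s + ->].
rewrite inE !in_chains_through => /andP[_ Ms].
by rewrite -tM full_chain_perm.
Qed.

(** * Members lying between two others *)

Definition below {T : finType} (F : {set {set T}}) (M : {set T}) := [set A in F | A \proper M].
Definition above {T : finType} (F : {set {set T}}) (M : {set T}) := [set B in F | M \proper B].
Definition middle {T : finType} (F : {set {set T}}) :=
  [set M in F | (0 < #|below F M|) && (0 < #|above F M|)].

Lemma butterfly_free_proper {T : finType} {F : {set {set T}}} (A B C D : {set T}) :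
  butterfly_free F -> A \in F -> B \in F -> C \in F -> D \in F ->
  A != B -> C != D -> A \proper C -> A \proper D -> B \proper C -> B \proper D ->
  False.
Proof.
move=> hF AF BF CF DF AB CD AC AD BC BD; apply: hF; exists A, B, C, D; split=> //.
have neq (X Y : {set T}) : X \proper Y -> X != Y.
  by rewrite properEneq => /andP[].
by rewrite /= !inE !negb_or AB CD !neq //= subUset !subsetI !proper_sub.
Qed.

(** Given [B] above [M], two members below [M] would form a butterfly with [M] and [B]. *)
Lemma below_middle {T : finType} (F : {set {set T}}) M :
  butterfly_free F -> M \in middle F -> #|below F M| <= 1.
Proof.
move=> hF; rewrite inE => /and3P[MF _ /card_gt0P[B]]; rewrite inE => /andP[BF MB].
apply/card_le1_eqP => A A'; rewrite !inE => /andP[AF AM] /andP[A'F A'M].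
apply/eqP/negPn/negP; rewrite eq_sym => AA'; apply: (butterfly_free_proper A A' M B hF) => //.
- by move: MB; rewrite properEneq => /andP[].
- exact: proper_trans AM MB.
- exact: proper_trans A'M MB.
Qed.

Lemma above_middle {T : finType} (F : {set {set T}}) M :
  butterfly_free F -> M \in middle F -> #|above F M| <= 1.
Proof.
move=> hF; rewrite inE => /and3P[MF /card_gt0P[A]]; rewrite inE => /andP[AF AM] _.
apply/card_le1_eqP => B B'; rewrite !inE => /andP[BF MB] /andP[B'F MB'].
apply/eqP/negPn/negP; rewrite eq_sym => BB'; apply: (butterfly_free_proper A M B B' hF) => //.
- by move: AM; rewrite properEneq => /andP[].
- exact: proper_trans AM MB.
- exact: proper_trans AM MB'.
Qed.

Lemma full_chain_proper n s A B :
  A \in full_chain n s -> B \in full_chain n s -> A != B ->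
  (A \proper B) || (B \proper A).
Proof.
move=> As Bs AB; rewrite !properEneq AB eq_sym AB /=.
case/orP: (leq_total #|A| #|B|) => [/(full_chain_sub n s A B As Bs)-> //|].
by move/(full_chain_sub n s B A Bs As)->; rewrite orbT.
Qed.

(** Of three members on a chain the second is middle, so a chain without middle members has at most
    two. Otherwise its middle member [M] is unique, and the other members on the chain are below or
    above [M]. The added term on the left offsets the sum on the right after summation over [s]. *)
Lemma full_chain_count n (F : {set {set 'I_n}}) s : butterfly_free F ->
  #|F :&: full_chain n s| + #|middle F :&: full_chain n s| <=
  2 + \sum_(M in middle F :&: full_chain n s)
    (#|below F M :&: full_chain n s| + #|above F M :&: full_chain n s|).
Proof.
move=> hF; set C := full_chain n s.
have midP X Y Z : X \in F -> Y \in F -> Z \in F -> X \proper Y -> Y \proper Z ->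
    Y \in middle F.
  move=> XF YF ZF XY YZ; rewrite inE YF /=; apply/andP; split; apply/card_gt0P.
    by exists X; rewrite inE XF.
  by exists Z; rewrite inE ZF.
have [F0|[M]] := set_0Vmem (middle F :&: C).
  rewrite F0 cards0 addn0 big_set0 addn0 leqNgt; apply/negP => /card_gt2P.
  have noM X Y Z : X \in F :&: C -> Y \in F :&: C -> Z \in F :&: C ->
      X \proper Y -> Y \proper Z -> False.
    move=> /setIP[XF _] /setIP[YF YC] /setIP[ZF _] XY YZ.
    have : Y \in middle F :&: C by rewrite in_setI YC (midP X Y Z).
    by rewrite F0 inE.
  case=> X [Y [Z [[XFC YFC ZFC] [XY YZ ZX]]]].
  have cmp U V : U \in F :&: C -> V \in F :&: C -> U != V ->
      U \proper V \/ V \proper U.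
    by move=> /setIP[_ UC] /setIP[_ VC] UV; apply/orP/(full_chain_proper n s).
  by case: (cmp X Y); case: (cmp Y Z); case: (cmp Z X) => //; eauto using noM.
move=> /[dup] MC /setIP[Mmid MCs].
have -> : middle F :&: C = [set M].
  apply/setP=> M'; rewrite in_set1; apply/idP/eqP => [/setIP[M'mid M'Cs]|-> //].
  apply/eqP/negPn/negP => neq.
  (* A member below [X] and [X] itself would be two members below the middle member [Y]. *)
  have no X Y : X \in middle F -> Y \in middle F -> X \proper Y -> False.
    move=> Xm Ym XY; have := below_middle F Y hF Ym => /card_le1_eqP le1.
    move: Xm; rewrite inE => /and3P[XF /card_gt0P[A]]; rewrite inE => /andP[AF AX] _.
    have AX' : A = X by apply: le1; rewrite inE ?XF ?AF ?XY //= (proper_trans AX).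
    by rewrite AX' properxx in AX.
  by case/orP: (full_chain_proper n s _ _ M'Cs MCs neq); apply: no.
rewrite cards1 big_set1 addn1 ltnS -add1n.
have sub : F :&: C \subset M |: ((below F M :&: C) :|: (above F M :&: C)).
  apply/subsetP=> X /setIP[XF XC]; rewrite in_setU1 in_setU !in_setI XC !andbT.
  have [//|XM /=] := eqVneq X M; rewrite !inE XF /=.
  exact: (full_chain_proper n s).
apply: leq_trans (subset_leq_card sub) _; rewrite cardsU1.
by apply: leq_add; [case: (_ \notin _) | apply: leq_card_setU].
Qed.

(** * Averaging over full chains *)

Lemma lubell_butterfly_free n (F : {set {set 'I_n}}) :
  butterfly_free F -> set0 \notin F -> setT \notin F ->
  \sum_(A in F) #|chains_through n A| <= 2 * n`!.
Proof.
move=> hF F0 FT.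
(* At most one member lies below [M] and one above, each on at most half of the chains through
   [M]. *)
have half M : M \in middle F ->
    \sum_(s in chains_through n M)
      (#|below F M :&: full_chain n s| + #|above F M :&: full_chain n s|) <=
    #|chains_through n M|.
  move=> Mm; rewrite big_split /= !sum_card_full_chain.
  have sum1 (G : {set {set 'I_n}}) : #|G| <= 1 -> (forall A, A \in G ->
      #|chains_through n A :&: chains_through n M| * 2 <= #|chains_through n M|) ->
      (\sum_(A in G) #|chains_through n A :&: chains_through n M|) * 2 <=
      #|chains_through n M|.
    move=> G1 GM; rewrite big_distrl /=; apply: (@leq_trans (\sum_(A in G) #|chains_through n M|)).
      exact: leq_sum.
    by rewrite sum_nat_const -[leqRHS]mul1n leq_mul2r G1 orbT.
  have MF : M \in F by move: Mm; rewrite inE => /andP[].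
  have bM : (\sum_(A in below F M) #|chains_through n A :&: chains_through n M|) * 2
      <= #|chains_through n M|.
    apply: sum1 => [|A]; first exact: below_middle.
    rewrite inE => /andP[AF /properP[AM [y yM yA]]].
    (* Both swapped points lie in [M]; [x] exists because [set0] is not in [F]. *)
    have /set0Pn[x xA] : A != set0 by apply: contraNneq F0 => <-.
    by apply: (chains_through_half n A M x y) => //; rewrite yM (subsetP AM).
  have aM : (\sum_(A in above F M) #|chains_through n A :&: chains_through n M|) * 2
      <= #|chains_through n M|.
    apply: sum1 => [|B]; first exact: above_middle.
    rewrite inE => /andP[BF /properP[MB [x xB xM]]].
    (* Both swapped points lie outside [M]; [y] exists because [setT] is not in [F]. *)
    have /set0Pn[y yB] : ~: B != set0.
      by apply: contraNneq FT => B0; rewrite -setC0 -B0 setCK.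
    rewrite inE in yB; apply: (chains_through_half n B M x y) => //.
    by rewrite (negPf xM); apply/esym/negbTE; apply: contra yB; apply: (subsetP MB).
  by rewrite -(leq_pmul2r (ltn0Sn 1)) mulnDl [leqRHS]muln2 -addnn leq_add.
have : \sum_s (#|F :&: full_chain n s| + #|middle F :&: full_chain n s|) <=
    \sum_s (2 + \sum_(M in middle F :&: full_chain n s)
      (#|below F M :&: full_chain n s| + #|above F M :&: full_chain n s|)).
  by apply: leq_sum => s _; apply: full_chain_count.
rewrite [leqLHS]big_split [leqRHS]big_split /= !sum_chains_through.
rewrite sum_nat_const card_Sn mulnC => le1.
rewrite -(leq_add2r (\sum_(A in middle F) #|chains_through n A|)).
apply: leq_trans le1 _; rewrite leq_add2l.
rewrite (exchange_big_dep (mem (middle F))) /=; last by move=> s M _ /setIP[].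
apply: leq_sum => M Mm; apply: leq_trans (half M Mm); apply: eq_leq.
by apply: eq_bigl => s; rewrite in_setI Mm in_chains_through.
Qed.

Lemma card_le_of_lubell n (F : {set {set 'I_n}}) :
  \sum_(A in F) #|chains_through n A| <= 2 * n`! ->
  #|F| <= 'C(n, n %/ 2) + 'C(n, (n %/ 2).+1).
Proof.
move=> lub; set h := n %/ 2; set a := 'C(n, h); set b := 'C(n, h.+1).
have ba : b <= a by apply: leq_bin_decr; lia.
have hn : h <= n by lia.
rewrite -(leq_pmul2l (fact_gt0 n)).
(* Each member is charged [b] per chain through it, plus a surcharge [a - b] on level [h]. The total
   is at most n! times 2b + (a - b) = a + b, since the level has weight at most n!. *)
have term A : A \in F -> n`! <=
    #|chains_through n A| * b + (if #|A| == h then #|chains_through n A| else 0) * (a - b).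
  move=> _; rewrite -(card_chains_through n A).
  have cA : #|A| <= n by rewrite -[n in _ <= n]card_ord max_card.
  case: eqP => [->|/eqP Ah]; first by rewrite -mulnDr subnKC.
  by rewrite addn0 leq_mul2l leq_bin_off_middle ?orbT.
rewrite mulnC -sum_nat_const; apply: leq_trans; first exact: leq_sum term.
rewrite big_split /= -!big_distrl /= -big_mkcondr /=.
have lev : \sum_(A in F | #|A| == h) #|chains_through n A| <= n`!.
  rewrite -(sum_level n h hn); rewrite [leqLHS]big_mkcond [leqRHS]big_mkcond.
  by apply: leq_sum => A _; case: (A \in F); case: (_ == _).
apply: leq_trans (leq_add (leq_mul lub (leqnn b)) (leq_mul lev (leqnn (a - b)))) _.
by rewrite -mulnA mulnCA -mulnDr leq_mul2l; apply/orP; right; lia.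
Qed.

(** * Removing the empty set, and complementation *)

Lemma butterfly_free_set0 n (F : {set {set 'I_n}}) :
  1 < n -> butterfly_free F -> set0 \in F ->
  #|F| <= n.*2 \/ exists F' : {set {set 'I_n}},
    [/\ butterfly_free F', #|F'| = #|F|, set0 \notin F' &
        setT \notin F -> setT \notin F'].
Proof.
move=> n1 hF F0.
(* With [set0] in [F], a nonempty member properly below two others completes a butterfly. *)
have noV B C D : B \in F -> C \in F -> D \in F -> B != set0 -> C != D ->
    B \proper C -> B \proper D -> False.
  move=> BF CF DF B0 CD BC BD.
  apply: (butterfly_free_proper set0 B C D hF) => //; first by rewrite eq_sym.
    by rewrite -proper0 in B0; apply: proper_trans BC.
  by rewrite -proper0 in B0; apply: proper_trans BD.
have [/forallP all1|nall1] := boolP [forall x, [set x] \in F]; [left | right].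
  (* By [noV], members of [G] sharing a point [y] would both contain the member [[set y]], so [G] is
     pairwise disjoint. Choosing in each a point other than [x0] is then injective, whence
     [#|G| <= n.-1]; the default [x0] is never taken on [G]. Adding [set0] and the singletons gives
     2n. *)
  pose x0 := Ordinal (ltnW n1); pose G := [set A in F | 1 < #|A|].
  pose f A := odflt x0 [pick y in A :\ x0].
  have fG A : A \in G -> f A \in A :\ x0.
    rewrite inE /f => /andP[_ A1]; case: pickP => //= A0.
    by move: A1; rewrite (cardsD1 x0) (eq_card0 A0); case: (_ \in _).
  have finj : {in G &, injective f}.
    move=> A B AG BG fAB; have := fG _ AG; have := fG _ BG; rewrite -fAB.
    move: (f A) AG BG => y; rewrite !inE => /andP[AF A1] /andP[BF B1].
    move=> /andP[_ yB] /andP[_ yA]; apply/eqP/negPn/negP => AB.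
    apply: (noV [set y] A B) => //; first by apply/set0Pn; exists y; rewrite inE.
      by rewrite properEcard sub1set yA cards1.
    by rewrite properEcard sub1set yB cards1.
  have cG : #|G| <= n.-1.
    rewrite -(card_in_imset finj) -[n in n.-1]card_ord -(cardsC1 x0).
    apply: subset_leq_card; apply/subsetP=> _ /imsetP[A AG ->].
    by have := fG _ AG; rewrite !inE => /andP[].
  have cS : #|[set [set x] | x : 'I_n]| = n by rewrite card_imset ?card_ord //; apply: set1_inj.
  have sub : F \subset set0 |: ([set [set x] | x : 'I_n] :|: G).
    apply/subsetP=> A AF; rewrite in_setU1 in_setU [A \in G]inE AF /=.
    case: (ltngtP #|A| 1) => [|_|/eqP/cards1P[x ->]]; last 2 first.
    - by rewrite !orbT.
    - by rewrite imset_f ?orbT.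
    by rewrite ltnS leqn0 cards_eq0 => ->.
  apply: leq_trans (subset_leq_card sub) _; rewrite cardsU1.
  apply: (@leq_trans (1 + (n + n.-1))); last by lia.
  rewrite leq_add ?leq_b1 //; apply: leq_trans (leq_card_setU _ _) _.
  by rewrite cS leq_add2l.
case/forallPn: nall1 => x xF; exists ([set x] |: F :\ set0).
have x0 : set0 != [set x] by rewrite eq_sym; apply/set0Pn; exists x; rewrite inE.
have noF : set0 \notin [set x] |: F :\ set0 by rewrite !inE negb_or x0 eqxx.
split=> //.
- case=> A [B [C [D [[AF BF CF DF] [uq]]]]].
  rewrite subUset !subsetI => /andP[/andP[AC AD] /andP[BC BD]].
  move: uq; rewrite /= !inE !negb_or andbT => /and3P[/and3P[nAB nAC nAD] /andP[nBC nBD] nCD].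
  (* The only proper subset of [[set x]] is [set0], which was removed, so the upper sets [C] and [D]
     are in [F]. One of [A], [B] differs from [[set x]] and contradicts [noV]. *)
  have old X Y : X \in [set x] |: F :\ set0 -> Y \in [set x] |: F :\ set0 ->
      X != Y -> X \subset Y -> Y \in F.
    move=> XF; rewrite in_setU1 => /orP[/eqP ->|/setD1P[] //].
    by rewrite subset1 => /negPf -> /= /eqP X0; rewrite X0 (negPf noF) in XF.
  have new X : X \in [set x] |: F :\ set0 -> X != [set x] -> (X \in F) /\ X != set0.
    by rewrite in_setU1 => /orP[->//|/setD1P[-> ->]].
  have CF' := old A C AF CF nAC AC; have DF' := old A D AF DF nAD AD.
  have [Ax|/(new A AF)[AF' A0]] := eqVneq A [set x]; last first.
    by apply: (noV A C D) => //; rewrite properEneq ?nAC ?nAD.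
  have [BF' B0] : B \in F /\ B != set0 by apply: new; rewrite // -Ax eq_sym.
  by apply: (noV B C D) => //; rewrite properEneq ?nBC ?nBD.
- by rewrite cardsU1 in_setD1 (negPf xF) andbF [in RHS](cardsD1 set0) F0.
- move=> FT; rewrite !inE negb_or negb_and FT orbT andbT.
  by apply/eqP => Tx; have := cards1 x; rewrite -Tx cardsT card_ord; lia.
Qed.

Lemma butterfly_free_setC {T : finType} (F : {set {set T}}) :
  butterfly_free F -> butterfly_free [set A | ~: A \in F].
Proof.
move=> hF [A [B [C [D [[]]]]]]; rewrite !inE => AF BF CF DF [uq sub]; apply: hF.
exists (~: C), (~: D), (~: A), (~: B); split=> //; split; last first.
  by rewrite -setCI -setCU setCS.
(* Complementation exchanges the lower and upper pairs, hence a rotation by two. *)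
rewrite -[X in uniq X]/(rot 2 (map (@setC T) [:: A; B; C; D])) rot_uniq.
by rewrite map_inj_uniq //; apply: setC_inj.
Qed.

Lemma card_setC_family {T : finType} (F : {set {set T}}) :
  #|[set A | ~: A \in F]| = #|F|.
Proof.
rewrite -(card_imset F (@setC_inj T)); apply: eq_card => A; rewrite inE.
by rewrite -(mem_imset F (~: A) (@setC_inj T)) setCK.
Qed.

Theorem theorem1 (n : nat) (hn : 3 <= n) (F : {set {set 'I_n}})
    (hF : butterfly_free F) :
  #|F| <= 'C(n, n %/ 2) + 'C(n, (n %/ 2).+1).
Proof.
(* This absorbs the alternative [#|F| <= n.*2]; [3 <= n] puts both levels strictly between 0 and
   [n]. *)
have big : n.*2 <= 'C(n, n %/ 2) + 'C(n, (n %/ 2).+1).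
  by rewrite -addnn leq_add // leq_bin_inner //; lia.
have noT (G : {set {set 'I_n}}) : butterfly_free G -> setT \notin G ->
    #|G| <= 'C(n, n %/ 2) + 'C(n, (n %/ 2).+1).
  move=> hG GT; have [G0|G0] := boolP (set0 \in G); last first.
    by apply: card_le_of_lubell; apply: lubell_butterfly_free.
  have [/leq_trans|[G' [hG' <- G'0 /(_ GT) G'T]]] :=
    butterfly_free_set0 n G (ltnW hn) hG G0; first exact.
  by apply: card_le_of_lubell; apply: lubell_butterfly_free.
have [FT|] := boolP (setT \in F); last exact: noT.
(* Complements turn [setT] into [set0], which is exchanged away. Complementing back gives a family
   without [setT], possibly with [set0], as [noT] allows. *)
have hc := butterfly_free_setC F hF; rewrite -(card_setC_family F).
have c0 : set0 \in [set A | ~: A \in F] by rewrite inE setC0.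
have [/leq_trans|[G [hG <- G0 _]]] := butterfly_free_set0 n _ (ltnW hn) hc c0.
  exact.
rewrite -(card_setC_family G); apply: noT; first exact: butterfly_free_setC.
by rewrite inE setCT.
Qed.
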